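(* For every integer $n\ge 0$ and every real $x$, $$\sum_{k=0}^{n}(-1)^kB_k^n(x)=(1-2x)^n,$$ where $B_k^n$ denotes the Bernstein basis function.
   Context: The Bernstein basis functions are $B_k^n(x)=\binom{n}{k}x^k(1-x)^{n-k}$ for integers $0\le k\le n$ (with $0^0=1$). *)

(* Defs.v *)
From mathcomp Require Import all_boot all_order all_algebra.
From mathcomp Require Import reals.
Set Implicit Arguments.
Unset Strict Implicit.
Unset Printing Implicit Defensive.
Import GRing.Theory.
Local Open Scope ring_scope.

(* Meant for k <= n. As y ^+ 0 = 1 for every y, the convention 0^0 = 1 holds. *)
Definition bernstein (R : realType) (n k : nat) (x : R) : R :=
  'C(n, k)%:R * x ^+ k * (1 - x) ^+ (n - k).

(* Main.v *)
Require Import Defs.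
From mathcomp Require Import all_boot all_order all_algebra.
From mathcomp Require Import reals.
Import GRing.Theory.
Local Open Scope ring_scope.

(** Absorbing the sign into the power, [(-1) ^+ k * x ^+ k = (- x) ^+ k], turns the sum into the
    binomial expansion ([exprDn]) of [((1 - x) + - x) ^+ n]. *)

Theorem theorem3 (R : realType) (n : nat) (x : R) :
  \sum_(0 <= k < n.+1) (-1) ^+ k * bernstein n k x = (1 - 2 * x) ^+ n.
Proof.
(* [exprDn] gives the exponent [n - k] to the first summand and [k] to the second, so [1 - x] comes
   first, matching [bernstein]. *)
have -> : 1 - 2 * x = (1 - x) + - x by rewrite mulr_natl mulr2n opprD addrA.
rewrite exprDn big_mkord; apply: eq_bigr => k _.
(* [exprNn] splits the sign off [(- x) ^+ k]; the rest is commutativity. *)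
by rewrite /bernstein [(- x) ^+ k]exprNn -mulrA mulrCA mulr_natl mulrA [in RHS]mulrC.
Qed.
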